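(* Let $(x_k,y_k)\in\mathbb{Z}^d\times\mathbb{Z}^d$ $(1\le k\le N-1)$ and $(\alpha,\beta)\in(\mathbb{R}^d\times\mathbb{R}^d)\setminus(\mathbb{Z}^d\times\mathbb{Z}^d)$, and assume that $0\ne f\in\mathcal{S}(\mathbb{R}^d)$ and $c_1,\dots,c_{N-1}\in\mathbb{C}$ satisfy $\sum_{k=1}^{N-1}c_kM_{y_k}T_{x_k}f=M_\beta T_\alpha f$. Let $\gamma=(-\alpha,\beta)$, $H=\overline{\{n\gamma\bmod\mathbb{Z}^{2d}:n\in\mathbb{Z}\}}\subset\mathbb{T}^{2d}$, $p(t,\omega)=\sum_{k=1}^{N-1}c_ke^{-2\pi i\langle y_k,t\rangle}e^{-2\pi i\langle\omega,x_k\rangle}$, $F=|Zf|$ and $S=\{z\in\mathbb{T}^{2d}:F(z)\ne0\}$. For each $z\in S$ define $$\Theta(z):=\int_H\log|p(z+h)|\,dm_H(h).$$ Then the following hold. (i) The function $\Theta$ is well defined on $S$ and is constant on every coset $z+H$, $z\in S$. (ii) For every $z\in S$, $$\lim_{n\to\infty}\frac{\log F(z+n\gamma)-\log F(z)}{n}=\Theta(z).$$ (iii) The function $\Theta$ is real-analytic on each connected component of $S$. (iv) $\Theta(z)=0$ for every $z\in S$.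
   Context: Here $d\ge1$, $N\ge2$ are integers, $\langle\cdot,\cdot\rangle$ is the standard inner product on $\mathbb{R}^d$, $\mathcal{S}(\mathbb{R}^d)$ is the Schwartz space, and $\mathbb{T}^n=\mathbb{R}^n/\mathbb{Z}^n$; periodic functions on $\mathbb{R}^n$ are identified with functions on $\mathbb{T}^n$ (so $p$ is regarded as a function on $\mathbb{T}^{2d}$). Time-frequency shifts: $T_xf(t)=f(t-x)$, $M_yf(t)=e^{-2\pi i\langle y,t\rangle}f(t)$. Zak transform: $Zf(t,\omega)=\sum_{\kappa\in\mathbb{Z}^d}e^{-2\pi i\langle\omega,\kappa\rangle}f(t+\kappa)$ on $\mathbb{R}^d\times\mathbb{R}^d$. Its modulus $F=|Zf|$ is $\mathbb{Z}^{2d}$-periodic and is regarded as a continuous function on $\mathbb{T}^{2d}$. $H$ is a closed subgroup of $\mathbb{T}^{2d}$ and $m_H$ is its normalized Haar measure. *)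

(* Defs.v *)
From HB Require Import structures.
From mathcomp Require Import all_boot all_order all_algebra.
From mathcomp Require Import generic_quotient ring_quotient finmap.
From mathcomp Require Import all_classical all_reals all_analysis.
From mathcomp Require Import complex.
From mathcomp Require summability.

Set Implicit Arguments.
Unset Strict Implicit.
Unset Printing Implicit Defensive.

Import Order.TTheory GRing.Theory Num.Theory.
Import numFieldNormedType.Exports.

Local Open Scope classical_set_scope.
Local Open Scope complex_scope.
Local Open Scope ring_scope.

Section ComplexFunctions.
Context {R : realType}.

(* [cis a] is $e^{ia}$. *)
Definition cis (a : R) : R[i] := cos a +i* sin a.

(* Unconditional sum: the limit of the sums over finite subsets of the index
   type, taken on real and imaginary parts. *)
Definition csum (I : choiceType) (u : I -> R[i]) : R[i] :=
  summability.sum (fun i => complex.Re (u i)) +i*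
  summability.sum (fun i => complex.Im (u i)).

Variable d : nat.
Implicit Types (f : 'rV[R]_d -> R[i]) (t w x y : 'rV[R]_d).

Definition dotrv x y : R := \sum_(i < d) x 0 i * y 0 i.

Definition rv_of_int (k : 'rV[int]_d) : 'rV[R]_d := map_mx intr k.

Definition translation x f : 'rV[R]_d -> R[i] := fun t => f (t - x).

Definition modulation y f : 'rV[R]_d -> R[i] :=
  fun t => cis (- (2 * pi * dotrv y t)) * f t.

Definition zak f t w : R[i] :=
  csum (fun k : 'rV[int]_d =>
    cis (- (2 * pi * dotrv w (rv_of_int k))) * f (t + rv_of_int k)).

Definition re_fun f : 'rV[R]_d -> R := fun t => complex.Re (f t).
Definition im_fun f : 'rV[R]_d -> R := fun t => complex.Im (f t).

Definition basis_rv (j : 'I_d) : 'rV[R]_d := delta_mx 0 j.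

Definition cpartial (j : 'I_d) f : 'rV[R]_d -> R[i] :=
  fun t => 'D_(basis_rv j) (re_fun f) t +i* 'D_(basis_rv j) (im_fun f) t.

(* [cpartials [:: j1; ...; jm] f] is $\partial_{j1}\cdots\partial_{jm} f$. *)
Definition cpartials (s : seq 'I_d) f : 'rV[R]_d -> R[i] := foldr cpartial f s.

Definition smooth f : Prop := forall s : seq 'I_d,
  [/\ continuous (re_fun (cpartials s f)),
      continuous (im_fun (cpartials s f)) &
      forall (j : 'I_d) t,
        derivable (re_fun (cpartials s f)) t (basis_rv j) /\
        derivable (im_fun (cpartials s f)) t (basis_rv j)].

Definition rv_monomial (a : {ffun 'I_d -> nat}) t : R :=
  \prod_(i < d) t 0 i ^+ a i.

(* Lists of directions play the role of the differentiation multi-indices. *)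
Definition schwartz f : Prop :=
  smooth f /\
  forall (a : {ffun 'I_d -> nat}) (s : seq 'I_d), exists M : R,
    forall t, Normc.normc ((rv_monomial a t)%:C * cpartials s f t) <= M.

Definition analytic_at (g : 'rV[R]_d -> R) x : Prop :=
  exists (a : {ffun 'I_d -> nat} -> R) (r : R), 0 < r /\
    forall v : 'rV[R]_d, `|v| < r ->
      summability.partial_sum (fun m => a m * rv_monomial m v)
        @ summability.totally --> g (x + v).

(* The arguments (t, w) are the two halves of a vector of length 2d. *)
Definition zak_modulus f (v : 'rV[R]_(d + d)) : R :=
  Normc.normc (zak f (lsubmx v) (rsubmx v)).

Definition trig_poly (m : nat) (x y : 'I_m -> 'rV[int]_d) (c : 'I_m -> R[i])
    (v : 'rV[R]_(d + d)) : R[i] :=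
  \sum_(k < m) c k * cis (- (2 * pi * dotrv (rv_of_int (y k)) (lsubmx v)))
                   * cis (- (2 * pi * dotrv (rsubmx v) (rv_of_int (x k)))).

End ComplexFunctions.

Definition int_lattice (R : realType) (n : nat) : {pred 'rV[R]_n} :=
  fun v => [forall i, v 0 i \is a Num.int].

Fact int_lattice_zmod_closed (R : realType) n : zmod_closed (@int_lattice R n).
Proof.
split=> [|u v /forallP uZ /forallP vZ]; apply/forallP => i; rewrite !mxE.
  exact: rpred0.
by rewrite rpredB.
Qed.

HB.instance Definition _ (R : realType) (n : nat) :=
  GRing.isZmodClosed.Build 'rV[R]_n (@int_lattice R n)
    (@int_lattice_zmod_closed R n).

(* $\mathbb{R}^n/\mathbb{Z}^n$ with the quotient group structure, the quotient
   topology and the Borel sigma-algebra. *)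
Definition torus (R : realType) (n : nat) : Type :=
  quotient_topology (Quotient.quot (@int_lattice R n)).

Definition torus_pi {R : realType} {n : nat} (x : 'rV[R]_n) : torus R n :=
  (\pi_(torus R n)%qT x).

Section Torus.
Variables (R : realType) (n : nat).

HB.instance Definition _ := Quotient.on (torus R n).
HB.instance Definition _ := Topological.on (torus R n).
HB.instance Definition _ :=
  GRing.isZmodule.Build (torus R n)
    (@Quotient.addqA _ (@int_lattice R n)) (@Quotient.addqC _ _)
    (@Quotient.add0q _ _) (@Quotient.addNq _ _).
HB.instance Definition _ := isPointed.Build (torus R n) 0.
HB.instance Definition _ :=
  Measurable.copy (torus R n) (g_sigma_algebraType (@open (torus R n))).

Fact torus_pi_zmod_morphism : zmod_morphism (@torus_pi R n).
Proof.
by move=> x y; rewrite /torus_pi [LHS]Quotient.pi_add Quotient.pi_opp.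
Qed.

HB.instance Definition _ :=
  GRing.isZmodMorphism.Build _ _ (@torus_pi R n) torus_pi_zmod_morphism.

Fact torus_pi_eq (x y : 'rV[R]_n) :
  (torus_pi x == torus_pi y) = (x - y \in @int_lattice R n).
Proof. by rewrite Quotient.idealrBE; apply/eqP/eqP. Qed.

(* The function on the torus induced by a lattice-periodic function on
   $\mathbb{R}^n$; see [on_torusE]. *)
Definition on_torus (U : Type) (g : 'rV[R]_n -> U) : torus R n -> U :=
  fun z => g (repr z).

Fact on_torusE (U : Type) (g : 'rV[R]_n -> U) :
  (forall x k, k \in @int_lattice R n -> g (x + k) = g x) ->
  forall x, on_torus g (torus_pi x) = g x.
Proof.
move=> gP x; have /eqP := reprK (torus_pi x).
by rewrite torus_pi_eq => /gP <-; rewrite addrC subrK.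
Qed.

Definition cyclic_closure (g : torus R n) : set (torus R n) :=
  closure (range (fun k : int => g *~ k)).

(* The normalized Haar measure of a closed subgroup [H], viewed as a Borel
   probability on the whole torus that is carried by [H]. *)
Definition is_normalized_haar (H : set (torus R n))
    (mu : probability (torus R n) R) : Prop :=
  mu H = 1%E /\
  forall (h : torus R n) (A : set (torus R n)), H h -> measurable A ->
    A `<=` H -> mu [set h + z | z in A] = mu A.

Definition analytic_on_torus (A : set (torus R n)) (g : torus R n -> R) : Prop :=
  forall x : 'rV[R]_n, A (torus_pi x) -> analytic_at (g \o torus_pi) x.

End Torus.

(* Main.v *)
Require Import Defs.
From HB Require Import structures.
From mathcomp Require Import all_boot all_order all_algebra finmap.
From mathcomp Require Import all_classical all_reals all_analysis.
From mathcomp Require Import measurable_realfun.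
From mathcomp Require Import complex ring lra zify.
From mathcomp Require Import summability.

Set Implicit Arguments.
Unset Strict Implicit.
Unset Printing Implicit Defensive.

Import Order.TTheory GRing.Theory Num.Theory.
Import numFieldNormedType.Exports.

Local Open Scope classical_set_scope.
Local Open Scope complex_scope.
Local Open Scope ring_scope.

(** The cocycle [|p|] over the rotation by [gamma] is a coboundary on [S].
    Applying the Zak transform to the linear dependence gives
    [F (z + gamma) = |p z| * F z] on the torus: integer time-frequency shifts
    only multiply [zak f] by characters, the sum of which is [p], and the shift
    by [(alpha, beta)] translates it by [gamma] up to a unimodular factor
    ([zak_modulus_shift]).

    The zero set [Z] of [F] is closed, by continuity of [F], and the functional
    equation maps it into itself by [z |-> z + gamma].  The rotation is
    recurrent, since [gamma *+ m.+1] can be made arbitrarily close to [0]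
    ([torus_recurrence]), so [z - gamma] is a limit of points
    [z + gamma *+ m] of [Z]; hence [Z] is invariant under [- gamma] also, and,
    being closed, under the whole group [H] ([zero_set_sub_cyclic_closure]).
    Its complement [S] is therefore a union of cosets of [H].

    On a coset [z + H] in [S], [F] is thus continuous and positive on a compact
    set, so [L := ln F] is bounded there, [p] does not vanish, and
    [ln |p| = L (_ + gamma) - L].  A difference of two translates of a bounded
    function is integrable with Haar integral [0], so [Theta = 0] on [S]; a
    bounded sequence divided by [n] tends to [0], which is the growth rate; and
    [Theta] is analytic as it vanishes on an open set.

    The analytic input is the continuity of [F].  A Schwartz function is bounded
    by a multiple of [\prod_i (1 + t_i ^ 2)^-1], whose translates by the integer
    lattice have, locally uniformly in [t], a common summable majorant
    ([schwartz_translates_majorant]), so the series defining the Zak transform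
    converges unconditionally and locally uniformly. *)

(** * Unconditional sums dominated by a summable family *)

#[local] Existing Instance totally_filter.

Section Sums.
Context {R : realType}.

Lemma ler_sum_uniq_subset (T : eqType) (s t : seq T) (g : T -> R) :
  uniq s -> uniq t -> {subset s <= t} -> (forall x, 0 <= g x) ->
  \sum_(x <- s) g x <= \sum_(x <- t) g x.
Proof.
move=> us ut st g0.
have /(perm_big _)-> : perm_eq t (s ++ [seq x <- t | x \notin s]).
  apply: uniq_perm => //.
    rewrite cat_uniq us filter_uniq// andbT -all_predC.
    by apply/allP => x; rewrite mem_filter => /andP[].
  move=> x; rewrite mem_cat mem_filter.
  by have [/st ->|] := boolP (x \in s).
by rewrite big_cat/= lerDl sumr_ge0.
Qed.

Variable I : choiceType.
Implicit Types (w u : I -> R) (A : {fset I}).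

Lemma partial_sumE u A : partial_sum u A = \sum_(i <- A) u i.
Proof. by rewrite /partial_sum (big_seq_fsetE _ _ xpredT u). Qed.

Definition majorant w := (forall i, 0 <= w i) /\
  exists B, forall A, \sum_(i <- A) w i <= B.

Lemma majorantZ a w : 0 <= a -> majorant w -> majorant (fun i => a * w i).
Proof.
move=> a0 [w0 [B wB]]; split=> [i|]; first exact: mulr_ge0.
by exists (a * B) => A; rewrite -mulr_sumr ler_wpM2l.
Qed.

(** Outside a finite set [A0] whose sum is within [e] of the supremum of the
    finite sums of [w], every finite sum of [w] is below [e].  The same [A0]
    serves all families dominated by [w]: this uniformity is what yields
    continuity in a parameter. *)
Lemma majorant_tail w (e : R) : majorant w -> 0 < e ->
  exists A0 : {fset I}, forall u, (forall i, `|u i| <= w i) ->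
  forall A, (A0 `<=` A)%fset -> `|partial_sum u A - partial_sum u A0| <= e.
Proof.
move=> [w0 [B wB]] e0.
pose E := [set \sum_(i <- (A : {fset I})) w i | A in [set: {fset I}]].
have hE : has_sup E.
  split; first by exists (\sum_(i <- (fset0 : {fset I})) w i), fset0.
  by exists B => _ [A _ <-].
have [_ [A0 _ <-] hA0] := sup_adherent e0 hE.
exists A0 => u uw A A0A; rewrite !partial_sumE.
have split_sum (v : I -> R) : \sum_(i <- A) v i =
    \sum_(i <- A0) v i + \sum_(i <- (A `\` A0)%fset) v i.
  rewrite (big_fsetID _ (mem A0)) /=; congr (_ + _); apply: perm_big;
    apply: uniq_perm => // i; rewrite !inE ?(rwP fsetDP) //=.
    have [iA0|] := boolP (i \in A0); last by rewrite andbF.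
    by rewrite (fsubsetP A0A).
  by rewrite andbC.
rewrite split_sum addrAC subrr add0r (le_trans (ler_norm_sum _ _ _))//.
rewrite (@le_trans _ _ (\sum_(i <- (A `\` A0)%fset) w i))//; first exact: ler_sum.
have : \sum_(i <- A) w i <= sup E by apply: sup_upper_bound => //; exists A.
rewrite split_sum => h; move: hA0; rewrite ltrBlDr => hA0.
by rewrite -(lerD2l (\sum_(i <- A0) w i)) (le_trans h)// ltW.
Qed.

Lemma majorant_cvg w u : majorant w -> (forall i, `|u i| <= w i) ->
  cvg (partial_sum u @ totally).
Proof.
move=> mw uw; apply/cauchy_cvgP; apply: cauchy_exP => e e0.
have [A0 hA0] := majorant_tail mw (divr_gt0 e0 (ltr0n _ 2)).
exists (partial_sum u A0); exists A0 => //= A A0A.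
rewrite /ball/= distrC (le_lt_trans (hA0 _ uw _ A0A))//.
by rewrite ltr_pdivrMr// ltr_pMr// ltr1n.
Qed.

Lemma majorant_sum_tail w (e : R) : majorant w -> 0 < e ->
  exists A0 : {fset I}, forall u, (forall i, `|u i| <= w i) ->
  `|summability.sum u - partial_sum u A0| <= e.
Proof.
move=> mw e0; have [A0 hA0] := majorant_tail mw e0; exists A0 => u uw.
have uc := majorant_cvg mw uw.
have nc : `|partial_sum u A - partial_sum u A0| @[A --> totally] -->
   `|summability.sum u - partial_sum u A0|.
  by apply: cvg_norm; apply: cvgB => //; exact: cvg_cst.
rewrite -(cvg_lim _ nc)//; apply: limr_le; first by apply/cvg_ex; eexists; exact: nc.
by exists A0 => //= A; exact: hA0.
Qed.

Lemma cvg_partial_sum (T : topologicalType) (u : I -> T -> R) A t0 :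
  (forall i, {for t0, continuous (u i)}) ->
  partial_sum (u ^~ t) A @[t --> t0] --> partial_sum (u ^~ t0) A.
Proof.
move=> uc; rewrite /partial_sum.
by apply: cvg_big => [|i _]; [exact: add_continuous|exact: uc].
Qed.

(** The Weierstrass test: the finite sums approximate the total sum uniformly
    near [t0]. *)
Lemma continuous_sum (T : topologicalType) (w : I -> R) (u : I -> T -> R) t0 :
  majorant w ->
  (\forall t \near t0, forall i, `|u i t| <= w i) ->
  (forall i, {for t0, continuous (u i)}) ->
  {for t0, continuous (fun t => summability.sum (u ^~ t))}.
Proof.
move=> mw uw uc; apply/cvgrPdist_le => /= e e0.
have e30 : 0 < e / 3 by rewrite divr_gt0.
have [A0 hA0] := majorant_sum_tail mw e30.
have u0 := nbhs_singleton uw.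
have /cvgrPdist_le/(_ _ e30) near_A0 := @cvg_partial_sum _ u A0 t0 uc.
near=> t.
have ut : forall i, `|u i t| <= w i by near: t.
have h1 := hA0 _ u0; have h2 := hA0 _ ut; rewrite distrC in h2.
have h3 : `|partial_sum (u ^~ t0) A0 - partial_sum (u ^~ t) A0| <= e / 3.
  by near: t.
move: h1 h2 h3; rewrite !ler_norml => /andP[? ?] /andP[? ?] /andP[? ?].
by apply/andP; split; lra.
Unshelve. all: by end_near. Qed.

Lemma cvg_partial_sum_reindex u (l : R) (s s' : I -> I) :
  cancel s s' -> cancel s' s ->
  partial_sum u @ totally --> l -> partial_sum (u \o s) @ totally --> l.
Proof.
move=> sK s'K ul.
have -> : partial_sum (u \o s) = partial_sum u \o (fun A => [fset s i | i in A]%fset).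
  apply/funext => A /=; rewrite !partial_sumE big_imfset//=.
  by move=> i j _ _; exact: can_inj sK _ _.
apply: cvg_comp ul => P [A0 _ A0P]; exists [fset s' i | i in A0]%fset => //= A A0A.
apply: A0P => /=; apply/fsubsetP => i iA0; apply/imfsetP; exists (s' i) => //=.
by apply: (fsubsetP A0A); apply/imfsetP; exists i.
Qed.

(** Unlike the total function [csum], this relation records convergence, so it
    is stable under linear operations and reindexing. *)
Definition csums (u : I -> R[i]) (s : R[i]) :=
  partial_sum (fun i => complex.Re (u i)) @ totally --> complex.Re s /\
  partial_sum (fun i => complex.Im (u i)) @ totally --> complex.Im s.

Lemma csumsE (u : I -> R[i]) s : csums u s -> csum u = s.
Proof.
by case: s => a b [/= ua ub]; rewrite /csum /summability.sum (cvg_lim _ ua)// (cvg_lim _ ub).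
Qed.

Lemma normc_ge0 (z : R[i]) : 0 <= Normc.normc z.
Proof. by case: z => a b; exact: sqrtr_ge0. Qed.

Lemma normc_ge_ReIm (z : R[i]) :
  `|complex.Re z| <= Normc.normc z /\ `|complex.Im z| <= Normc.normc z.
Proof.
case: z => a b /=; rewrite -!sqrtr_sqr.
by split; rewrite ler_wsqrtr// ?lerDl ?lerDr sqr_ge0.
Qed.

Lemma majorant_csums w (u : I -> R[i]) : majorant w ->
  (forall i, Normc.normc (u i) <= w i) -> csums u (csum u).
Proof.
move=> mw uw; split; apply: (majorant_cvg mw) => i; apply: le_trans (uw i);
  by case: (normc_ge_ReIm (u i)).
Qed.

Lemma csumsZ a (u : I -> R[i]) s : csums u s -> csums (fun i => a * u i) (a * s).
Proof.
case=> ur ui; split.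
  rewrite (_ : partial_sum _ = fun A => complex.Re a *
      partial_sum (fun i => complex.Re (u i)) A - complex.Im a *
      partial_sum (fun i => complex.Im (u i)) A); last first.
    apply/funext => A; rewrite !partial_sumE !mulr_sumr -sumrB.
    by apply: eq_bigr => i _; case: a (u i) => ? ? [].
  have -> : complex.Re (a * s) = complex.Re a * complex.Re s - complex.Im a * complex.Im s.
    by case: a s {ur ui} => ? ? [].
  by apply: cvgB; apply: cvgMr.
rewrite (_ : partial_sum _ = fun A => complex.Re a *
    partial_sum (fun i => complex.Im (u i)) A + complex.Im a *
    partial_sum (fun i => complex.Re (u i)) A); last first.
  apply/funext => A; rewrite !partial_sumE !mulr_sumr -big_split.
  by apply: eq_bigr => i _; case: a (u i) => ? ? [].
have -> : complex.Im (a * s) = complex.Re a * complex.Im s + complex.Im a * complex.Re s.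
  by case: a s {ur ui} => ? ? [].
by apply: cvgD; apply: cvgMr.
Qed.

Lemma csums_sum m (u : 'I_m -> I -> R[i]) (s : 'I_m -> R[i]) :
  (forall k, csums (u k) (s k)) ->
  csums (fun i => \sum_k u k i) (\sum_k s k).
Proof.
move=> us; split.
  rewrite (_ : partial_sum _ = fun A => \sum_k partial_sum (fun i => complex.Re (u k i)) A).
    rewrite raddf_sum; apply: cvg_big => [|k _]; first exact: add_continuous.
    by case: (us k).
  apply/funext => A; rewrite /partial_sum exchange_big/=.
  by apply: eq_bigr => i _; rewrite raddf_sum.
rewrite (_ : partial_sum _ = fun A => \sum_k partial_sum (fun i => complex.Im (u k i)) A).
  rewrite raddf_sum; apply: cvg_big => [|k _]; first exact: add_continuous.
  by case: (us k).
apply/funext => A; rewrite /partial_sum exchange_big/=.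
by apply: eq_bigr => i _; rewrite raddf_sum.
Qed.

Lemma csums_reindex (u : I -> R[i]) l (s s' : I -> I) :
  cancel s s' -> cancel s' s -> csums u l -> csums (u \o s) l.
Proof.
by move=> sK s'K [ur ui]; split; apply: (cvg_partial_sum_reindex sK s'K (u := fun i => _ (u i))).
Qed.

End Sums.

(** * A summable weight on the integer lattice *)

Section Lattice.
Context {R : realType}.

Definition inv1sqr (j : int) : R := (1 + (j%:~R) ^+ 2)^-1.

Lemma inv1sqr_ge0 j : 0 <= inv1sqr j.
Proof. by rewrite invr_ge0 addr_ge0// sqr_ge0. Qed.

(** The bound telescopes: [(1 + x ^ 2)^-1 <= 3 / ((x + 1) * (x + 2))] at every
    natural number [x]. *)
Lemma sum_inv1sqr_nat n : \sum_(i <- iota 0 n) inv1sqr (Posz i) <= 3 - 3 / n.+1%:R.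
Proof.
elim: n => [|n IHn]; first by rewrite big_nil divr1 subrr.
rewrite -[n.+1]addn1 iotaD big_cat/= big_seq1 add0n.
apply: le_trans (lerD IHn (lexx _)) _.
rewrite /inv1sqr -pmulrn addn1 -!natr1; set x : R := n%:R.
have x0 : 0 <= x by rewrite ler0n.
have x1 : x + 1 > 0 by lra.
have x2 : x + 1 + 1 > 0 by lra.
have sx : 1 + x ^+ 2 > 0 by rewrite ltr_pwDl// sqr_ge0.
have : 3 / (x + 1) - 3 / (x + 1 + 1) = 3 / ((x + 1) * (x + 1 + 1)).
  by field; rewrite !gt_eqF.
suff : (1 + x ^+ 2)^-1 <= 3 / ((x + 1) * (x + 1 + 1)) by lra.
rewrite ler_pdivlMr ?mulr_gt0// mulrC ler_pdivrMr//.
(* The inequality left is [(2 x - 1) (x - 1) >= 0], false between 1/2 and 1. *)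
have [x12|[x12|x12]] : x = 0 \/ x = 1 \/ 2 <= x.
  rewrite /x; case: (n) => [|[|k]]; [by left|by right; left|].
  by right; right; rewrite (ler_nat R 2).
all: by rewrite ?x12; nra.
Qed.

Lemma sum_inv1sqr (E : seq int) : uniq E -> \sum_(j <- E) inv1sqr j <= 6.
Proof.
move=> uE; have [n jn] : exists n, forall j : int, j \in E -> (`|j| < n)%N.
  exists (\max_(j <- E) `|j|%N).+1 => j jE.
  by rewrite ltnS; apply: leq_bigmax_seq.
pose t := [seq Posz i | i <- iota 0 n] ++ [seq Negz i | i <- iota 0 n].
have ut : uniq t.
  rewrite cat_uniq !map_inj_uniq ?iota_uniq// ?andbT; [|by move=> ? ? []..].
  by apply/hasPn => _ /mapP[i _ ->]; apply/negP => /mapP[].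
have Et : {subset E <= t}.
  move=> j /jn; rewrite mem_cat; case: j => j /= jn'; apply/orP; [left|right];
    apply/mapP; exists j => //; rewrite mem_iota add0n//=; lia.
apply: (le_trans (ler_sum_uniq_subset uE ut Et inv1sqr_ge0)).
rewrite big_cat/= !big_map.
have h1 := sum_inv1sqr_nat n.
have h2 : \sum_(i <- iota 0 n) inv1sqr (Negz i) <= \sum_(i <- iota 0 n) inv1sqr (Posz i).
  (* [Negz i] is [- (i + 1)], whose square exceeds that of [i]. *)
  apply: ler_sum => i _; rewrite /inv1sqr NegzE mulrNz sqrrN -!pmulrn lef_pV2 ?posrE.
  - by rewrite lerD2l lerXn2r ?nnegrE ?ler0n// ler_nat.
  - by rewrite ltr_pwDl// sqr_ge0.
  - by rewrite ltr_pwDl// sqr_ge0.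
have : 0 <= 3 / n.+1%:R :> R by rewrite divr_ge0.
move=> h3; apply: (le_trans (lerD h1 (le_trans h2 h1))).
by move: h3; set z := _ / _; lra.
Qed.

Definition lattice_weight (d : nat) (k : 'rV[int]_d) : R :=
  \prod_(i < d) inv1sqr (k 0 i).

(** A finite set of lattice points lies in a cube [E ^ d], over which the sum of
    the products is the [d]-th power of the sum over [E]. *)
Lemma lattice_weight_majorant d : majorant (@lattice_weight d).
Proof.
split=> [k|]; first by apply: prodr_ge0 => i _; exact: inv1sqr_ge0.
exists (6 ^+ d) => A.
pose E : {fset int} :=
  [fset z in [seq (k : 'rV[int]_d) 0 i | k <- enum_fset A, i <- enum 'I_d]]%fset.
pose row_of (f : {ffun 'I_d -> E}) : 'rV[int]_d := \row_i val (f i).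
have row_inj : injective row_of.
  by move=> f g /rowP fg; apply/ffunP => i; apply: val_inj; have := fg i; rewrite !mxE.
have sub : {subset A <= [seq row_of f | f <- enum {: {ffun 'I_d -> E}}]}.
  move=> k kA; apply/mapP.
  have kE i : k 0 i \in E by rewrite !inE; apply/allpairsP; exists (k, i); rewrite mem_enum.
  exists [ffun i => [` kE i]%fset]; first by rewrite mem_enum.
  by apply/rowP => i; rewrite !mxE ffunE.
apply: (le_trans (ler_sum_uniq_subset (fset_uniq A) _ sub _)).
- by rewrite map_inj_uniq ?enum_uniq.
- by move=> k; apply: prodr_ge0 => i _; exact: inv1sqr_ge0.
rewrite big_map big_enum/=.
rewrite (eq_bigr (fun f : {ffun 'I_d -> E} => \prod_(i < d) inv1sqr (val (f i)))); last first.
  by move=> f _; apply: eq_bigr => i _; rewrite mxE.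
rewrite -(bigA_distr_bigA (fun (i : 'I_d) (j : E) => inv1sqr (val j))) /=.
rewrite prodr_const card_ord; apply: lerXn2r; rewrite ?nnegrE ?ler0n//.
  by apply: sumr_ge0 => j _; exact: inv1sqr_ge0.
by rewrite -(big_seq_fsetE _ E xpredT inv1sqr) sum_inv1sqr// fset_uniq.
Qed.

End Lattice.

(** * Zak transform of a Schwartz function *)

Section Zak.
Context {R : realType} {d : nat}.
Implicit Types (f : 'rV[R]_d -> R[i]) (t w : 'rV[R]_d).

Lemma ler_coord_norm n (v : 'rV[R]_n) i : `|v 0 i| <= `|v|.
Proof.
by rewrite [leRHS]/Num.norm /= mx_normrE; apply/bigmax_geP; right; exists (0, i).
Qed.

(** The product expands into the monomials [\prod_(i not in A) t_i ^ 2], each of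
    which is bounded against [f]. *)
Lemma schwartz_decay f : schwartz f ->
  exists M, forall t, Normc.normc (f t) * \prod_(i < d) (1 + t 0 i ^+ 2) <= M.
Proof.
move=> [_ fS].
pose a (A : {set 'I_d}) : {ffun 'I_d -> nat} := [ffun i => if i \in A then 0 else 2]%N.
have /choice[M hM] : forall A : {set 'I_d}, exists M : R, forall t,
    Normc.normc (f t) * rv_monomial (a A) t <= M.
  move=> A; have [M hM] := fS (a A) [::]; exists M => t; apply: le_trans (hM t).
  rewrite Normc.normcM mulrC ler_wpM2r ?normc_ge0//=.
  by rewrite expr0n/= addr0 sqrtr_sqr ler_norm.
exists (\sum_A M A) => t.
rewrite bigA_distr mulr_sumr; apply: ler_sum => A _; apply: le_trans (hM A t).
rewrite le_eqVlt; apply/orP; left; apply/eqP; congr (_ * _).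
rewrite /rv_monomial; apply: eq_bigr => i _; rewrite ffunE.
by case: ifPn.
Qed.

Lemma le_1Dsqr (s k B : R) : `|s| <= B ->
  1 + k ^+ 2 <= 2 * (1 + B ^+ 2) * (1 + (s + k) ^+ 2).
Proof.
move=> sB; have B0 : 0 <= B by apply: le_trans sB.
have : s ^+ 2 <= B ^+ 2 by rewrite -real_normK ?num_real// lerXn2r ?nnegrE.
set b := B ^+ 2; have : 0 <= b * (s + k) ^+ 2 by rewrite mulr_ge0 ?sqr_ge0.
have : 0 <= (s + k + s) ^+ 2 by rewrite sqr_ge0.
nra.
Qed.

Lemma schwartz_translates_majorant f B : schwartz f ->
  exists2 w : 'rV[int]_d -> R, majorant w &
    forall t k, (forall i, `|t 0 i| <= B) -> Normc.normc (f (t + rv_of_int k)) <= w k.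
Proof.
move=> /schwartz_decay[M hM].
pose K := (2 * (1 + B ^+ 2)) ^+ d.
have B1 : 0 < 2 * (1 + B ^+ 2) by rewrite mulr_gt0// ltr_pwDl// sqr_ge0.
have M0 : 0 <= M.
  apply: le_trans (hM 0); rewrite mulr_ge0 ?normc_ge0//.
  by apply: prodr_ge0 => i _; rewrite addr_ge0// sqr_ge0.
exists (fun k => M * K * lattice_weight k).
  by apply: majorantZ; [rewrite mulr_ge0// exprn_ge0// ltW|exact: lattice_weight_majorant].
move=> t k tB; have := hM (t + rv_of_int k).
set N := Normc.normc _; set P := \prod_(i < d) _ => NP.
have N0 : 0 <= N by exact: normc_ge0.
have h : 1 <= P * (K * lattice_weight k).
  rewrite /P /K /lattice_weight -[d in _ ^+ d]card_ord -prodr_const -!big_split/=.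
  apply: (big_ind (fun z => 1 <= z)) => [//|x y x1 y1|i _]; first by rewrite mulr_ege1.
  rewrite /inv1sqr !mxE mulrA ler_pdivlMr ?ltr_pwDl ?sqr_ge0// mul1r mulrC.
  exact: le_1Dsqr.
rewrite -mulrA; apply: (@le_trans _ _ (N * (P * (K * lattice_weight k)))).
  by rewrite ler_peMr.
rewrite [leLHS]mulrA ler_wpM2r// mulr_ge0 ?exprn_ge0 ?(ltW B1)//.
by case: (lattice_weight_majorant (R := R) d).
Qed.

Lemma normc_cis (a : R) : Normc.normc (cis a) = 1.
Proof. by rewrite /cis /= cos2Dsin2 sqrtr1. Qed.

Lemma cisD (a b : R) : cis (a + b) = cis a * cis b.
Proof.
rewrite /cis cosD sinD; simpc; congr (_ +i* _).
by rewrite addrC [X in _ + X]mulrC [X in X + _]mulrC.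
Qed.

Lemma cis0 : cis (0 : R) = 1.
Proof. by rewrite /cis cos0 sin0. Qed.

Lemma cisN_mul (a : R) : cis (- a) * cis a = 1.
Proof. by rewrite -cisD addNr cis0. Qed.

Lemma cis_int (m : int) : cis (2 * pi * m%:~R : R) = 1.
Proof.
have natc (n : nat) : cis (2 * pi * n%:R : R) = 1.
  elim: n => [|n IHn]; first by rewrite mulr0 cis0.
  by rewrite -(natr1 n) mulrDr mulr1 cisD IHn mul1r /cis mulr_natl cos2pi sin2pi.
case: m => n; first exact: natc.
by have := cisN_mul (2 * pi * n.+1%:R); rewrite natc mulr1 NegzE mulrNz mulrN.
Qed.

Lemma cis2piND (a b : R) :
  cis (- (2 * pi * (a + b))) = cis (- (2 * pi * a)) * cis (- (2 * pi * b)).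
Proof. by rewrite (mulrDr (2 * pi)) opprD cisD. Qed.

Lemma dotrvDl (x y z : 'rV[R]_d) : dotrv (x + y) z = dotrv x z + dotrv y z.
Proof. by rewrite /dotrv -big_split; apply: eq_bigr => i _; rewrite mxE mulrDl. Qed.

Lemma dotrvDr (x y z : 'rV[R]_d) : dotrv z (x + y) = dotrv z x + dotrv z y.
Proof. by rewrite /dotrv -big_split; apply: eq_bigr => i _; rewrite mxE mulrDr. Qed.

Lemma dotrvNr (x z : 'rV[R]_d) : dotrv z (- x) = - dotrv z x.
Proof. by rewrite /dotrv -sumrN; apply: eq_bigr => i _; rewrite mxE mulrN. Qed.

Lemma rv_of_intD (k l : 'rV[int]_d) : rv_of_int (k + l) = rv_of_int k + rv_of_int l :> 'rV[R]_d.
Proof. by apply/rowP => i; rewrite !mxE intrD. Qed.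

Lemma rv_of_intN (k : 'rV[int]_d) : rv_of_int (- k) = - rv_of_int k :> 'rV[R]_d.
Proof. by apply/rowP => i; rewrite !mxE intrN. Qed.

Lemma cis_dotrv_int (k l : 'rV[int]_d) :
  cis (- (2 * pi * dotrv (rv_of_int k) (rv_of_int l)) : R) = 1.
Proof.
rewrite (_ : dotrv _ _ = (\sum_i k 0 i * l 0 i)%:~R); last first.
  by rewrite rmorph_sum; apply: eq_bigr => i _; rewrite !mxE rmorphM.
by rewrite -mulrN -intrN cis_int.
Qed.

Definition zak_term f t w (k : 'rV[int]_d) : R[i] :=
  cis (- (2 * pi * dotrv w (rv_of_int k))) * f (t + rv_of_int k).

Lemma normc_zak_term f t w k :
  Normc.normc (zak_term f t w k) = Normc.normc (f (t + rv_of_int k)).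
Proof. by rewrite Normc.normcM normc_cis mul1r. Qed.

Lemma zak_csums f t w : schwartz f -> csums (zak_term f t w) (zak f t w).
Proof.
move=> /(@schwartz_translates_majorant _ `|t|)[u mu fu].
apply: (majorant_csums mu) => k; rewrite normc_zak_term; apply: fu => i.
exact: ler_coord_norm.
Qed.


(** Shifting the time variable by a lattice vector reindexes the Zak series, which only
    produces a character of the frequency. *)
Lemma zak_shift f t w (l : 'rV[int]_d) : schwartz f ->
  zak f (t + rv_of_int l) w = cis (2 * pi * dotrv w (rv_of_int l)) * zak f t w.
Proof.
move=> fS; have lK : cancel (fun k => k + l) (fun k : 'rV[int]_d => k - l).
  exact: addrK.
have lK' : cancel (fun k : 'rV[int]_d => k - l) (fun k => k + l) by exact: subrK.
have /csumsE <- := csumsZ (cis (2 * pi * dotrv w (rv_of_int l)))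
  (csums_reindex lK lK' (zak_csums t w fS)).
congr csum; apply/funext => k; rewrite /zak_term /= rv_of_intD dotrvDr cis2piND.
rewrite -addrA [rv_of_int l + _]addrC -[LHS]mul1r.
by rewrite -(cisN_mul (2 * pi * dotrv w (rv_of_int l))); ring.
Qed.

Lemma zak_shift_freq f t w (l : 'rV[int]_d) : zak f t (w + rv_of_int l) = zak f t w.
Proof.
congr csum; apply/funext => k; congr (_ * _).
by rewrite dotrvDl cis2piND cis_dotrv_int mulr1.
Qed.

Lemma zak_modulation_translation f t w x y : schwartz f ->
  csums (zak_term (modulation y (translation x f)) t w)
        (cis (- (2 * pi * dotrv y t)) * zak f (t - x) (w + y)).
Proof.
move=> fS; rewrite (_ : zak_term _ _ _ =
    fun k => cis (- (2 * pi * dotrv y t)) * zak_term f (t - x) (w + y) k).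
  exact/csumsZ/zak_csums.
apply/funext => k; rewrite /zak_term /modulation /translation addrAC dotrvDl dotrvDr !cis2piND.
ring.
Qed.

End Zak.

(** * The Zak modulus: continuity, periodicity, functional equation *)

Lemma continuous_addr (K : numFieldType) (V : normedModType K) (a : V) :
  continuous (fun x => x + a).
Proof. by move=> x; apply: cvgD; [exact: cvg_id|exact: cvg_cst]. Qed.

Section ComplexContinuous.
Context {R : realType} {T : topologicalType}.

Definition ccontinuous (g : T -> R[i]) :=
  continuous (fun t => complex.Re (g t)) /\ continuous (fun t => complex.Im (g t)).

Lemma ccontinuousM (g h : T -> R[i]) :
  ccontinuous g -> ccontinuous h -> ccontinuous (fun t => g t * h t).
Proof.
move=> [gr gi] [hr hi]; split.
  rewrite (_ : (fun t => _) = fun t => complex.Re (g t) * complex.Re (h t) -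
      complex.Im (g t) * complex.Im (h t)); last first.
    by apply/funext => t; case: (g t) (h t) => ? ? [].
  by move=> v; apply: cvgB; apply: cvgM; [exact: gr|exact: hr|exact: gi|exact: hi].
rewrite (_ : (fun t => _) = fun t => complex.Re (g t) * complex.Im (h t) +
    complex.Im (g t) * complex.Re (h t)); last first.
  by apply/funext => t; case: (g t) (h t) => ? ? [].
by move=> v; apply: cvgD; apply: cvgM; [exact: gr|exact: hi|exact: gi|exact: hr].
Qed.

Lemma ccontinuous_cis (s : T -> R) : continuous s ->
  ccontinuous (fun t => cis (- (2 * pi * s t))).
Proof.
move=> cs; have cth : continuous (fun t => - (2 * pi * s t)).
  by move=> t; apply: cvgN; apply: cvgMr; exact: cs.
split=> t /=.
- apply: (@continuous_comp _ _ _ (fun t => - (2 * pi * s t)) cos).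
    exact: cth.
  exact: continuous_cos.
- apply: (@continuous_comp _ _ _ (fun t => - (2 * pi * s t)) sin).
    exact: cth.
  exact: continuous_sin.
Qed.

Lemma normc_continuous_at (g : T -> R[i]) t :
  {for t, continuous (fun t => complex.Re (g t))} ->
  {for t, continuous (fun t => complex.Im (g t))} ->
  {for t, continuous (fun t => Normc.normc (g t))}.
Proof.
move=> gr gi; rewrite (_ : (fun t => _) = fun t => Num.sqrt
    (complex.Re (g t) ^+ 2 + complex.Im (g t) ^+ 2)); last first.
  by apply/funext => z; case: (g z).
apply: (@continuous_comp _ _ _ (fun t => complex.Re (g t) ^+ 2 +
     complex.Im (g t) ^+ 2) Num.sqrt); last exact: sqrt_continuous.
by apply: cvgD; under eq_fun do rewrite expr2; apply: cvgM.
Qed.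

End ComplexContinuous.

Section ZakModulus.
Context {R : realType} {d : nat}.
Implicit Types (f : 'rV[R]_d -> R[i]) (v : 'rV[R]_(d + d)).

Lemma int_lattice_rv_of_int n (k : 'rV[R]_n) :
  k \in @int_lattice R n -> exists m, k = rv_of_int m.
Proof.
move=> /forallP kZ; exists (\row_i Num.floor (k 0 i)).
by apply/rowP => i; rewrite !mxE floorK.
Qed.

Lemma lsubmxD (u v : 'rV[R]_(d + d)) : lsubmx (u + v) = lsubmx u + lsubmx v.
Proof. exact: linearD. Qed.

Lemma rsubmxD (u v : 'rV[R]_(d + d)) : rsubmx (u + v) = rsubmx u + rsubmx v.
Proof. exact: linearD. Qed.

Lemma lsubmx_rv_of_int (m : 'rV[int]_(d + d)) :
  lsubmx (rv_of_int m) = rv_of_int (lsubmx m) :> 'rV[R]_d.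
Proof. by apply/rowP => i; rewrite !mxE. Qed.

Lemma rsubmx_rv_of_int (m : 'rV[int]_(d + d)) :
  rsubmx (rv_of_int m) = rv_of_int (rsubmx m) :> 'rV[R]_d.
Proof. by apply/rowP => i; rewrite !mxE. Qed.

Lemma zak_modulus_periodic f v k : schwartz f ->
  k \in @int_lattice R (d + d) -> zak_modulus f (v + k) = zak_modulus f v.
Proof.
move=> fS /int_lattice_rv_of_int[m ->]; rewrite /zak_modulus !lsubmxD !rsubmxD.
rewrite lsubmx_rv_of_int rsubmx_rv_of_int zak_shift_freq zak_shift//.
by rewrite Normc.normcM normc_cis mul1r.
Qed.

Lemma trig_poly_periodic m (x y : 'I_m -> 'rV[int]_d) (c : 'I_m -> R[i]) v k :
  k \in @int_lattice R (d + d) -> trig_poly x y c (v + k) = trig_poly x y c v.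
Proof.
move=> /int_lattice_rv_of_int[l ->]; apply: eq_bigr => j _.
rewrite !lsubmxD !rsubmxD lsubmx_rv_of_int rsubmx_rv_of_int dotrvDl dotrvDr !cis2piND.
by rewrite !cis_dotrv_int !mulr1.
Qed.

(** Both sides are the norms of the Zak transforms of the two members of the
    dependence relation. *)
Lemma zak_modulus_shift m (x y : 'I_m -> 'rV[int]_d) (c : 'I_m -> R[i])
    (alpha beta : 'rV[R]_d) f v : schwartz f ->
  (forall t, \sum_(k < m)
      c k * modulation (rv_of_int (y k)) (translation (rv_of_int (x k)) f) t =
    modulation beta (translation alpha f) t) ->
  zak_modulus f (v + row_mx (- alpha) beta) =
  Normc.normc (trig_poly x y c v) * zak_modulus f v.
Proof.
move=> fS fdep; rewrite /zak_modulus !lsubmxD !rsubmxD row_mxKl row_mxKr.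
set t := lsubmx v; set w := rsubmx v.
have hl := csumsE (zak_modulation_translation t w alpha beta fS).
have hr := csums_sum (fun k => csumsZ (c k) (zak_modulation_translation t w
  (rv_of_int (x k)) (rv_of_int (y k)) fS)).
have e : (fun k => \sum_i c i * zak_term (modulation (rv_of_int (y i))
    (translation (rv_of_int (x i)) f)) t w k) =
    zak_term (modulation beta (translation alpha f)) t w.
  apply/funext => k; rewrite /zak_term -fdep [RHS]mulr_sumr.
  by apply: eq_bigr => i _; rewrite mulrCA.
rewrite -Normc.normcM -[LHS]mul1r -(normc_cis (- (2 * pi * dotrv beta t))).
rewrite -Normc.normcM -hl -e (csumsE hr) /trig_poly mulr_suml; congr Normc.normc.
apply: eq_bigr => k _; rewrite zak_shift_freq -rv_of_intN zak_shift//.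
by rewrite rv_of_intN dotrvNr mulrN -!mulrA.
Qed.

Lemma lsubmx_continuous : continuous (lsubmx : 'rV[R]_(d + d) -> 'rV[R]_d).
Proof.
move=> v; apply/(@cvgrPdist_le _ _ _ (nbhs v) (nbhs_filter v)) => /= e e0.
have /cvgrPdist_le/(_ _ e0) := @cvg_id _ (nbhs v); apply: filterS => u; apply: le_trans.
rewrite -linearB/= [leLHS]/Num.norm/= mx_normrE; apply/bigmax_leP; split=> // -[i j] _.
by rewrite mxE (ord1 i) ler_coord_norm.
Qed.

Lemma rsubmx_continuous : continuous (rsubmx : 'rV[R]_(d + d) -> 'rV[R]_d).
Proof.
move=> v; apply/(@cvgrPdist_le _ _ _ (nbhs v) (nbhs_filter v)) => /= e e0.
have /cvgrPdist_le/(_ _ e0) := @cvg_id _ (nbhs v); apply: filterS => u; apply: le_trans.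
rewrite -linearB/= [leLHS]/Num.norm/= mx_normrE; apply/bigmax_leP; split=> // -[i j] _.
by rewrite mxE (ord1 i) ler_coord_norm.
Qed.

Lemma dotrv_continuous (a : 'rV[R]_d) : continuous (fun x : 'rV[R]_d => dotrv x a).
Proof.
have sumC (T : topologicalType) (g : 'I_d -> T -> R) :
    (forall i, continuous (g i)) -> continuous (fun x => \sum_(i < d) g i x).
  move=> cg x; apply: cvg_big => [|i _]; first exact: add_continuous.
  exact: cg.
apply: (sumC _ (fun i (x : 'rV[R]_d) => x 0 i * a 0 i)) => i x.
have cx : {for x, continuous (fun y : 'rV[R]_d => y 0 i)} by exact: coord_continuous.
by apply: (@cvgMl _ _ (nbhs x) (nbhs_filter x)); exact: cx.
Qed.

Lemma zak_term_continuous f (k : 'rV[int]_d) : schwartz f ->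
  ccontinuous (fun v => zak_term f (lsubmx v) (rsubmx v) k).
Proof.
move=> [fs _]; have [/= cr ci _] := fs [::].
apply: ccontinuousM.
  apply: ccontinuous_cis.
  move=> v; apply: (@continuous_comp _ _ _ rsubmx (fun w => dotrv w (rv_of_int k))).
    exact: rsubmx_continuous.
  exact: dotrv_continuous.
have ct : continuous (fun v : 'rV[R]_(d + d) => lsubmx v + rv_of_int k).
  move=> v; apply: (@continuous_comp _ _ _ lsubmx (fun t => t + rv_of_int k)).
    exact: lsubmx_continuous.
  exact: continuous_addr.
split=> v.
- apply: (@continuous_comp _ _ _ (fun v => lsubmx v + rv_of_int k) (re_fun f)).
    exact: ct.
  exact: cr.
- apply: (@continuous_comp _ _ _ (fun v => lsubmx v + rv_of_int k) (im_fun f)).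
    exact: ct.
  exact: ci.
Qed.

Lemma zak_modulus_continuous f : schwartz f -> continuous (zak_modulus f).
Proof.
move=> fS v0.
have [u mu fu] := schwartz_translates_majorant (`|v0| + 1) fS.
have zu : \forall v \near v0, forall k,
    Normc.normc (zak_term f (lsubmx v) (rsubmx v) k) <= u k.
  have /cvgrPdist_le/(_ _ ltr01) := @cvg_id _ (nbhs v0).
  apply: filterS => v h k; rewrite normc_zak_term; apply: fu => i; rewrite mxE.
  apply: le_trans (ler_coord_norm _ _) _.
  rewrite distrC in h; rewrite -(subrK v0 v) addrC (le_trans (ler_normD _ _))//.
  by rewrite lerD2l.
have cR : {for v0, continuous (fun v => complex.Re (zak f (lsubmx v) (rsubmx v)))}.
  apply: (continuous_sum mu) => [|k]; last exact: (zak_term_continuous k fS).1.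
  apply: filterS zu => v h k; apply: le_trans (h k).
  by case: (normc_ge_ReIm (zak_term f (lsubmx v) (rsubmx v) k)).
have cI : {for v0, continuous (fun v => complex.Im (zak f (lsubmx v) (rsubmx v)))}.
  apply: (continuous_sum mu) => [|k]; last exact: (zak_term_continuous k fS).2.
  apply: filterS zu => v h k; apply: le_trans (h k).
  by case: (normc_ge_ReIm (zak_term f (lsubmx v) (rsubmx v) k)).
exact: (@normc_continuous_at R 'rV[R]_(d + d)
  (fun v => zak f (lsubmx v) (rsubmx v)) v0 cR cI).
Qed.

End ZakModulus.

(** * Topology of the torus and recurrence of rotations *)

Section TorusTopology.
Context {R : realType} {n : nat}.
Local Notation T := (torus R n).
Implicit Types (x : 'rV[R]_n) (z h g : T).

Lemma torus_pi_repr z : torus_pi (repr z) = z.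
Proof. exact: reprK. Qed.

Lemma torus_pi_continuous : continuous (@torus_pi R n).
Proof. exact: pi_continuous. Qed.

Lemma continuous_torus_pi (Z : topologicalType) (f : T -> Z) :
  continuous (f \o torus_pi) -> continuous f.
Proof. by move=> cf; apply/quotient_continuous. Qed.

Lemma torus_addr_continuous h : continuous (fun z => z + h).
Proof.
apply: continuous_torus_pi.
rewrite (_ : _ \o _ = torus_pi \o (fun x => x + repr h)); last first.
  by apply/funext => x /=; rewrite raddfD/= torus_pi_repr.
move=> x; apply: continuous_comp; first exact: continuous_addr.
exact: torus_pi_continuous.
Qed.

Lemma torus_opp_continuous : continuous (fun z => - z).
Proof.
apply: continuous_torus_pi.
rewrite (_ : _ \o _ = torus_pi \o -%R); last first.
  by apply/funext => x /=; rewrite raddfN.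
move=> x; apply: continuous_comp; first exact: opp_continuous.
exact: torus_pi_continuous.
Qed.

Lemma torus_addl_continuous z : continuous (fun h => z + h).
Proof. by under eq_fun do rewrite addrC; exact: torus_addr_continuous. Qed.

Lemma torus_subl_continuous z : continuous (fun h => z - h).
Proof.
move=> h; apply: (@continuous_comp _ _ _ (fun w : T => - w) (fun w => z + w)).
  exact: torus_opp_continuous.
exact: torus_addl_continuous.
Qed.

Lemma lattice_reduction x :
  exists2 e, torus_pi e = torus_pi x & forall i, e 0 i \in `[0, 1].
Proof.
exists (\row_i (x 0 i - (Num.floor (x 0 i))%:~R)) => [|i].
  apply/eqP; rewrite torus_pi_eq; apply/forallP => i; rewrite !mxE.
  by rewrite addrAC subrr sub0r rpredN intr_int.
rewrite mxE in_itv/= subr_ge0 Num.Theory.floor_le_tmp/= lerBlDr addrC.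
by rewrite -intrD1 ltW// Num.Theory.floorD1_gt.
Qed.

Lemma compact_unit_box : compact [set e : 'rV[R]_n | forall i, e ord0 i \in `[0, 1]].
Proof.
by apply: (@rV_compact R n (fun=> [set` `[0%R, 1%R : R]])) => _; exact: segment_compact.
Qed.

Lemma torus_compact : compact [set: T].
Proof.
rewrite (_ : setT = torus_pi @` [set e : 'rV[R]_n | forall i, e ord0 i \in `[0, 1]]).
  apply: continuous_compact compact_unit_box.
  by apply: continuous_subspaceT; exact: torus_pi_continuous.
apply/seteqP; split => // z _; have [e ez eI] := lattice_reduction (repr z).
by exists e => //; rewrite ez torus_pi_repr.
Qed.

(** Representatives in the unit box of the multiples of [g] accumulate at some
    point, and the difference of two of them near that point represents a
    positive multiple of [g]. *)
Lemma torus_recurrence g (d : R) : 0 < d ->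
  exists m (e : 'rV[R]_n), `|e| < d /\ torus_pi e = g *+ m.+1.
Proof.
move=> d0; have /choice[u hu] : forall k : nat, exists e : 'rV[R]_n,
    torus_pi e = g *+ k /\ forall i, e ord0 i \in `[0, 1].
  move=> k; have [e ek eI] := lattice_reduction (repr (g *+ k)).
  by exists e; split => //; rewrite ek torus_pi_repr.
have [|e [_ ce]] := @compact_unit_box (u @ \oo) _ _.
  by exists 0%N => // k _ /=; exact: (hu k).2.
have d20 : 0 < d / 2 by rewrite divr_gt0.
have be := nbhsx_ballx e _ d20.
have [_ [[k _ <-] ke]] : (range u `&` ball e (d / 2)) !=set0.
  by apply: ce be; exists 0%N => // k _; exists k.
have [_ [[l /= kl <-] le]] : (u @` [set l | (k < l)%N] `&` ball e (d / 2)) !=set0.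
  by apply: ce be; exists k.+1 => // l /= kl; exists l.
exists (l - k).-1, (u l - u k); split.
  rewrite -(subrKA e) (le_lt_trans (ler_normD _ _))// [ltRHS]splitr.
  rewrite ltrD//; last by move: ke; rewrite -ball_normE.
  by move: le; rewrite -ball_normE /= distrC.
rewrite raddfB/= (hu l).1 (hu k).1 prednK ?subn_gt0//.
by rewrite mulrnBr// ltnW.
Qed.

Section InvariantZeroSet.
Variables (F : T -> R) (g : T).
Hypotheses (Fc : continuous F) (Fg : forall z, F z = 0 -> F (z + g) = 0).

Lemma zero_set_add_mulrn z k : F z = 0 -> F (z + g *+ k) = 0.
Proof.
move=> z0; elim: k => [|k IHk]; first by rewrite mulr0n addr0.
by rewrite mulrSr addrA; exact: Fg.
Qed.

(** If [F (z - g)] were not [0], [F] would be nonzero near [z - g]; but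
    recurrence puts some [z - g + g *+ m.+1 = z + g *+ m], a zero of [F], there. *)
Lemma zero_set_sub z : F z = 0 -> F (z - g) = 0.
Proof.
move=> z0; apply/eqP; apply: contrapT => /negP Fz.
pose G e := F (torus_pi e + (z - g)).
have cG : continuous G.
  move=> e; apply: (@continuous_comp _ _ _ (fun e => torus_pi e + (z - g)) F); last exact: Fc.
  apply: (@continuous_comp _ _ _ (@torus_pi R n) (fun w => w + (z - g))).
    exact: torus_pi_continuous.
  exact: torus_addr_continuous.
have /cvgrPdist_lt/(_ `|G 0|) := cG 0.
rewrite normr_gt0 {1}/G raddf0 add0r => /(_ Fz)/nbhs_ballP[d /= d0 dG].
have [m [e [ed em]]] := torus_recurrence g d0.
have : `|G 0 - G e| < `|G 0| by apply: dG; rewrite -ball_normE /= sub0r normrN.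
rewrite [G e](_ : _ = 0) ?subr0 ?ltxx// /G em.
rewrite mulrSr addrACA subrr addr0 addrC.
exact: zero_set_add_mulrn.
Qed.

Lemma zero_set_add_mulrz z (k : int) : F z = 0 -> F (z + g *~ k) = 0.
Proof.
case: k => k z0; first by rewrite -pmulrn; exact: zero_set_add_mulrn.
rewrite NegzE mulrNz -pmulrn; elim: k => [|k IHk]; first exact: zero_set_sub.
by rewrite mulrSr opprD addrA; exact: zero_set_sub.
Qed.

Lemma zero_set_sub_cyclic_closure z h :
  cyclic_closure g h -> F z = 0 -> F (z - h) = 0.
Proof.
move=> Hh z0; have : closed ((fun h => F (z - h)) @^-1` [set 0]).
  apply: closed_comp => [w _|]; last exact: closed_eq.
  apply: (@continuous_comp _ _ _ (fun h => z - h) F); last exact: Fc.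
  exact: torus_subl_continuous.
move=> /closure_id e; suff : ((fun h => F (z - h)) @^-1` [set 0]) h by [].
rewrite e; apply: closure_subset Hh => _ [k _ <-] /=.
by rewrite -mulrNz; exact: zero_set_add_mulrz.
Qed.

End InvariantZeroSet.

Lemma cyclic_closure_gen g : cyclic_closure g g.
Proof. by apply: subset_closure; exists 1. Qed.

Lemma cyclic_closure_mulrn g k : cyclic_closure g (g *+ k).
Proof. by apply: subset_closure; exists k%:Z => //; rewrite -pmulrn. Qed.

Lemma closed_cyclic_closure g : closed (cyclic_closure g).
Proof. exact: closed_closure. Qed.

Lemma cyclic_closure_addz g h (k : int) :
  cyclic_closure g h -> cyclic_closure g (h + g *~ k).
Proof.
move=> Hh; have : closed ((fun w => w + g *~ k) @^-1` cyclic_closure g).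
  apply: closed_comp => [w _|]; last exact: closed_cyclic_closure.
  exact: torus_addr_continuous.
move=> /closure_id e; suff : ((fun w => w + g *~ k) @^-1` cyclic_closure g) h by [].
rewrite e; apply: closure_subset Hh => _ [l _ <-] /=.
by apply: subset_closure; exists (l + k) => //; rewrite mulrzDr.
Qed.

Lemma cyclic_closure_addr g h : cyclic_closure g h -> cyclic_closure g (h + g).
Proof. by move=> /(@cyclic_closure_addz _ _ 1); rewrite mulr1z. Qed.

Lemma cyclic_closure_subr g h : cyclic_closure g h -> cyclic_closure g (h - g).
Proof. by move=> /(@cyclic_closure_addz _ _ (-1)); rewrite mulrN1z. Qed.

Lemma compact_cyclic_closure g : compact (cyclic_closure g).
Proof. by apply: subclosed_compact torus_compact _ => //; exact: closed_cyclic_closure. Qed.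

End TorusTopology.

(** * Haar integrals over a closed subgroup *)

Section TorusMeasure.
Context {R : realType} {n : nat}.
Local Notation T := (torus R n).
Implicit Types (z h g : T).

Lemma torus_open_measurable (A : set T) : open A -> measurable A.
Proof. exact: sub_sigma_algebra. Qed.

Lemma torus_closed_measurable (A : set T) : closed A -> measurable A.
Proof.
move=> cA; rewrite -[A]setCK; apply: measurableC; apply: torus_open_measurable.
exact: closed_openC.
Qed.

Lemma measurable_cyclic_closure g : measurable (cyclic_closure g).
Proof. by apply: torus_closed_measurable; exact: closed_cyclic_closure. Qed.

Lemma torus_continuous_measurable_fun (F : T -> R) :
  continuous F -> measurable_fun [set: T] F.
Proof.
move=> /continuousP cF; apply: (measurability _ (RGenOpens.measurableE R)).
move=> _ [_ [a [b ->] <-]]; rewrite setTI; apply: torus_open_measurable.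
exact/cF/interval_open.
Qed.

Lemma torus_translation_measurable z : measurable_fun [set: T] (fun h => z + h).
Proof.
apply: (@measurability _ _ _ _ _ _ (@open T)) => // _ [A oA <-].
rewrite setTI; apply: torus_open_measurable.
by have /continuousP := @torus_addl_continuous R n z; exact.
Qed.

(** The translation maps [mu] to a measure that agrees with [mu] on the
    measurable subsets of [H]. *)
Lemma haar_integral_translation (H : set T) (mu : probability T R) g (L : T -> R) :
  measurable H -> is_normalized_haar H mu -> H g ->
  (forall h, H (g + h) <-> H h) ->
  measurable_fun [set: T] L -> [bounded L h | h in H] ->
  (\int[mu]_(h in H) (L (g + h))%:E = \int[mu]_(h in H) (L h)%:E)%E.
Proof.
move=> mH [_ muH] Hg Hgh mL bL.
have preH : (fun h => g + h) @^-1` H = H by apply/seteqP; split => h /Hgh.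
have mLg : measurable_fun [set: T] (fun h => L (g + h)).
  by apply: (measurableT_comp mL); exact: torus_translation_measurable.
have iL : mu.-integrable H (EFin \o (fun h => L (g + h))).
  apply: measurable_bounded_integrable => //.
  - by rewrite (le_lt_trans (probability_le1 _ _))// ltry.
  - exact: measurable_funTS.
  - case: bL => M [Mr hM]; exists M; split => // x Mx h Hh /=.
    by apply: hM => //; apply/Hgh.
rewrite -[in LHS]preH -(@integral_pushforward _ _ _ _ _ (fun h => g + h)
  (torus_translation_measurable g) mu H (EFin \o L)) //; first last.
- by rewrite preH.
- exact/measurable_EFinP.
apply: eq_measure_integral; first exact: torus_translation_measurable.
move=> mg A mA AH; rewrite /pushforward.
rewrite -[in RHS](_ : [set g + z | z in (fun h => g + h) @^-1` A] = A); last first.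
  apply/seteqP; split => [_ [z /= Az <-]//|z Az]; exists (z - g) => /=; by rewrite addrC subrK.
apply/esym/muH => // [|h /AH/Hgh//].
by rewrite -[X in measurable X]setTI; apply: torus_translation_measurable.
Qed.

End TorusMeasure.

(** * Multiplicative coboundaries over a rotation *)

Lemma cvg_inv_nat (R : realType) : (n%:R^-1 : R) @[n --> \oo] --> (0 : R).
Proof. by rewrite -cvg_shiftS; exact: cvg_harmonic. Qed.

Section Cocycle.
Context {R : realType} {n : nat}.
Local Notation T := (torus R n).
Variables (F q : T -> R) (g : T).
Hypotheses (Fc : continuous F) (F0 : forall z, 0 <= F z).
Hypothesis (Fg : forall z, F (z + g) = q z * F z).
Let H := cyclic_closure g.
Implicit Types z h : T.

(** A zero of [F] at [z + h] would propagate back to [z] along [H]. *)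
Lemma cocycle_support z h : H h -> F z != 0 -> F (z + h) != 0.
Proof.
have Fg0 w : F w = 0 -> F (w + g) = 0 by rewrite Fg => ->; rewrite mulr0.
move=> Hh; apply: contra_neq => Fzh.
by have := zero_set_sub_cyclic_closure Fc Fg0 Hh Fzh; rewrite addrK.
Qed.

Lemma cocycle_support_gt0 z h : H h -> F z != 0 -> 0 < F (z + h).
Proof. by move=> Hh Fz; rewrite lt_neqAle eq_sym F0 cocycle_support. Qed.

Lemma orbit_continuous z : continuous (fun h => F (z + h)).
Proof.
move=> h; apply: (@continuous_comp _ _ _ (fun h => z + h) F); last exact: Fc.
exact: torus_addl_continuous.
Qed.

Lemma ln_orbit_bounded z : F z != 0 -> [bounded ln (F (z + h)) | h in H].
Proof.
move=> Fz; have : compact ((fun h => ln (F (z + h))) @` H).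
  apply: continuous_compact; last exact: compact_cyclic_closure.
  apply: continuous_in_subspaceT => h; rewrite inE => Hh.
  apply: (@continuous_comp _ _ _ (fun h => F (z + h)) (@ln R)).
    exact: orbit_continuous.
  exact: continuous_ln (cocycle_support_gt0 Hh Fz).
move=> /compact_bounded[M [Mr hM]]; exists M; split => // x Mx h Hh /=.
by apply: hM => //; exists h.
Qed.

Lemma cyclic_closure_translation h : H (g + h) <-> H h.
Proof.
rewrite addrC; split=> Hh; last exact: cyclic_closure_addr.
by rewrite -(addrK g h); exact: cyclic_closure_subr.
Qed.

(** Along [z + H] both factors of [F (z + h + g) = q (z + h) * F (z + h)] stay
    positive, so the logarithm of [q] is a difference of finite terms. *)
Lemma lne_cocycle z h : H h -> F z != 0 ->
  lne (q (z + h))%:E = ((ln (F (z + (g + h))))%:E - (ln (F (z + h)))%:E)%E.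
Proof.
move=> Hh Fz; have Fzh := cocycle_support_gt0 Hh Fz.
have : 0 < F (z + (g + h)).
  by apply: cocycle_support_gt0 => //; apply/cyclic_closure_translation.
rewrite [g + h]addrC addrA Fg pmulr_lgt0// => q0.
by rewrite lne_EFin// lnM ?posrE// -EFinB addrK.
Qed.

Section Integral.
Variable mu : probability T R.

Lemma measurable_ln_orbit z : measurable_fun [set: T] (fun h => ln (F (z + h))).
Proof.
apply: (measurableT_comp (@measurable_ln R)).
apply: torus_continuous_measurable_fun; exact: orbit_continuous.
Qed.

Lemma integrable_ln_orbit z : F z != 0 ->
  mu.-integrable H (fun h => (ln (F (z + h)))%:E).
Proof.
move=> Fz; apply: measurable_bounded_integrable; first exact: measurable_cyclic_closure.
- apply: le_lt_trans (ltry 1); apply: probability_le1.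
  exact: measurable_cyclic_closure.
- by apply: measurable_funTS; exact: measurable_ln_orbit.
- exact: ln_orbit_bounded.
Qed.

Lemma integrable_ln_orbit_shift z : F z != 0 ->
  mu.-integrable H (fun h => (ln (F (z + (g + h))))%:E).
Proof.
move=> Fz; rewrite (_ : (fun h => _) = fun h => (ln (F (z + g + h)))%:E).
  by apply: integrable_ln_orbit; apply: cocycle_support Fz; exact: cyclic_closure_gen.
by apply/funext => h; rewrite addrA.
Qed.

Lemma cocycle_integrable z : F z != 0 ->
  mu.-integrable H (fun h => lne (q (z + h))%:E).
Proof.
have mH : measurable H by exact: measurable_cyclic_closure.
move=> Fz; have := integrableB mH (integrable_ln_orbit_shift Fz) (integrable_ln_orbit Fz).
by apply: eq_integrable => // h; rewrite inE => Hh; rewrite lne_cocycle.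
Qed.

Lemma cocycle_integral_eq0 z : is_normalized_haar H mu -> F z != 0 ->
  (\int[mu]_(h in H) lne (q (z + h))%:E = 0)%E.
Proof.
have mH : measurable H by exact: measurable_cyclic_closure.
move=> haar Fz.
rewrite (eq_integral (fun h => ((ln (F (z + (g + h))))%:E - (ln (F (z + h)))%:E)%E)).
  rewrite integralB//; [|exact: integrable_ln_orbit_shift|exact: integrable_ln_orbit].
  rewrite (haar_integral_translation (L := fun h => ln (F (z + h))) mH haar).
  - by rewrite subee// integrable_fin_num//; exact: integrable_ln_orbit.
  - exact: cyclic_closure_gen.
  - exact: cyclic_closure_translation.
  - exact: measurable_ln_orbit.
  - exact: ln_orbit_bounded.
by move=> h; rewrite inE => Hh; rewrite lne_cocycle.
Qed.

End Integral.

(** The numerators are values of [ln F] on [z + H], up to a constant, and these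
    are bounded. *)
Lemma cocycle_growth_rate z : F z != 0 ->
  (ln (F (z + g *+ k)) - ln (F z)) / k%:R @[k --> \oo] --> (0 : R).
Proof.
move=> Fz; have [M [Mr hM]] := ln_orbit_bounded Fz.
pose B := `|M| + 1 + `|ln (F z)|.
have MB : M < `|M| + 1 by rewrite ltr_pwDr// ler_norm.
have B0 : B / k%:R @[k --> \oo] --> (0 : R).
  by rewrite -(mulr0 B); apply: cvgMr; exact: cvg_inv_nat.
apply: (@squeeze_cvgr _ _ _ _ (fun k : nat => - (B / k%:R)) (fun k : nat => B / k%:R)) => //.
  apply: nearW => k; rewrite -ler_norml normrM normfV (ger0_norm (ler0n R k)).
  rewrite ler_wpM2r ?invr_ge0// (le_trans (ler_normB _ _))// lerD2r.
  by apply: (hM _ MB); exact: cyclic_closure_mulrn.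
by rewrite -oppr0; exact: cvgN.
Qed.

End Cocycle.

(** * Vanishing of the growth rate on the support of the Zak modulus *)

Lemma analytic_at_near0 (R : realType) (d : nat) (g : 'rV[R]_d -> R) x :
  (\forall u \near x, g u = 0) -> analytic_at g x.
Proof.
move=> /nbhs_ballP[r /= r0 gr]; exists (fun=> 0), r; split => // v vr.
rewrite (gr (x + v)); last by rewrite -ball_normE /= opprD addrA subrr sub0r normrN.
rewrite (_ : partial_sum _ = fun=> 0); first exact: cvg_cst.
by apply/funext => A; apply: big1 => i _; rewrite mul0r.
Qed.

Lemma torus_pi_near_neq0 (R : realType) (n : nat) (F : torus R n -> R) x :
  continuous F -> F (torus_pi x) != 0 -> \forall u \near x, F (torus_pi u) != 0.
Proof.
move=> Fc; have : continuous (F \o torus_pi).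
  by move=> u; apply: continuous_comp; [exact: torus_pi_continuous|exact: Fc].
by move=> /(_ x)/cvgr_neq0; apply.
Qed.

Theorem proposition3p2 (R : realType) (d N : nat)
    (d_ge1 : (1 <= d)%N) (N_ge2 : (2 <= N)%N)
    (x y : 'I_N.-1 -> 'rV[int]_d) (alpha beta : 'rV[R]_d)
    (nonint : row_mx alpha beta \notin @int_lattice R (d + d))
    (f : 'rV[R]_d -> R[i]) (f_schwartz : schwartz f) (f_neq0 : f <> cst 0)
    (c : 'I_N.-1 -> R[i])
    (dependence : forall t : 'rV[R]_d,
      \sum_(k < N.-1)
        c k * modulation (rv_of_int (y k)) (translation (rv_of_int (x k)) f) t
      = modulation beta (translation alpha f) t) :
  let gamma : torus R (d + d) := torus_pi (row_mx (- alpha) beta) in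
  let H : set (torus R (d + d)) := cyclic_closure gamma in
  let p : torus R (d + d) -> R[i] := on_torus (trig_poly x y c) in
  let F : torus R (d + d) -> R := on_torus (zak_modulus f) in
  let S : set (torus R (d + d)) := [set z | F z != 0] in
  forall mH : probability (torus R (d + d)) R, is_normalized_haar H mH ->
  let log_p (z h : torus R (d + d)) : \bar R :=
    lne (Normc.normc (p (z + h)))%:E in
  let Theta (z : torus R (d + d)) : \bar R := (\int[mH]_(h in H) log_p z h)%E in
  [/\ (forall z, S z -> mH.-integrable H (log_p z)) /\
      (forall z h, S z -> H h -> S (z + h) /\ Theta (z + h) = Theta z),
      forall z, S z ->
        ((ln (F (z + gamma *+ n)) - ln (F z)) / n%:R)%:E @[n --> \oo]
          --> Theta z,
      forall z, S z ->
        analytic_on_torus (connected_component S z) (fine \o Theta) &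
      forall z, S z -> Theta z = 0%E].
Proof.
move=> gamma H p F S mH haar log_p Theta.
have Fpi v : F (torus_pi v) = zak_modulus f v.
  by apply: on_torusE => u k kZ; exact: zak_modulus_periodic.
have ppi v : p (torus_pi v) = trig_poly x y c v.
  by apply: on_torusE => u k kZ; exact: trig_poly_periodic.
have Fc : continuous F.
  apply: continuous_torus_pi; rewrite (_ : F \o torus_pi = zak_modulus f).
    exact: zak_modulus_continuous.
  exact/funext.
have F0 z : 0 <= F z by exact: normc_ge0.
have Fg z : F (z + gamma) = Normc.normc (p z) * F z.
  rewrite -(torus_pi_repr z) ppi Fpi /gamma -raddfD Fpi.
  exact: zak_modulus_shift.
have SH z h : S z -> H h -> S (z + h).
  by move=> Sz Hh; exact: (cocycle_support Fc Fg Hh Sz).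
have Theta0 z : S z -> Theta z = 0%E.
  by move=> Sz; exact: (cocycle_integral_eq0 Fc F0 Fg haar Sz).
split; [split| | |exact: Theta0].
- by move=> z Sz; exact: (cocycle_integrable Fc F0 Fg mH Sz).
- move=> z h Sz Hh; split; first exact: SH.
  by rewrite (Theta0 _ Sz) (Theta0 _ (SH _ _ Sz Hh)).
- move=> z Sz; rewrite (Theta0 _ Sz); apply: cvg_EFin; first exact: nearW.
  exact: (cocycle_growth_rate Fc F0 Fg Sz).
- move=> z Sz v Cv; apply: analytic_at_near0.
  have Sv : S (torus_pi v) by exact: connected_component_sub Cv.
  have := torus_pi_near_neq0 Fc Sv; apply: filterS => u Su.
  by rewrite /comp (Theta0 _ Su).
Qed.
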